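(* Let $M\in\mathbb{R}^{m\times m}$ be nonsymmetric and positive definite, let $A\in\mathbb{R}^{m\times n}$ have full column rank, and let $b\in\mathbb{R}^n$, $b\neq 0$. Suppose that the nonsymmetric generalized Golub-Kahan process started from $b$ (described in the context) runs for $n$ steps, and let $Q=Q_n$, $V=V_n$, $B=B_n$, $H=H_n$ be the resulting matrices. Then the Schur complement $S=A^TM^{-1}A$ satisfies $$S=Q\,H_S\,Q^T,\qquad H_S=HB,$$ and $H_S$ is an upper Hessenberg matrix.
   Context: Positive definite means $x^TMx>0$ for all nonzero $x\in\mathbb{R}^m$ (no symmetry required). Write $\|x\|_M=\sqrt{x^TMx}$ and $\|\cdot\|_2$ for the Euclidean norm. Exact arithmetic is assumed. Nonsymmetric generalized Golub-Kahan process started from $b$: set $\beta_1=\|b\|_2$, $q_1=b/\beta_1$, $w_1=M^{-1}Aq_1$, $\alpha_1=\|w_1\|_M$, $v_1=w_1/\alpha_1$. For $j=2,3,\dots$: with $Q_{j-1}=[q_1,\dots,q_{j-1}]$, set $h_j=Q_{j-1}^TA^Tv_{j-1}=(\theta_{1,j},\dots,\theta_{j-1,j})^T$, $g_j=A^Tv_{j-1}-Q_{j-1}h_j$, $\beta_j=\|g_j\|_2$; if $\beta_j=0$ the process stops; otherwise $q_j=g_j/\beta_j$, $w_j=M^{-1}(Aq_j-\beta_jMv_{j-1})$, $\alpha_j=\|w_j\|_M$, $v_j=w_j/\alpha_j$. ''The process runs for $k$ steps'' means that $\beta_1,\dots,\beta_k$ are all nonzero, so that $q_1,\dots,q_k$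 and $v_1,\dots,v_k$ are defined. Matrices: $Q_k=[q_1,\dots,q_k]\in\mathbb{R}^{n\times k}$, $V_k=[v_1,\dots,v_k]\in\mathbb{R}^{m\times k}$. $B_k\in\mathbb{R}^{k\times k}$ is the upper bidiagonal matrix with diagonal $\alpha_1,\dots,\alpha_k$ and superdiagonal $\beta_2,\dots,\beta_k$ (that is, $(B_k)_{j-1,j}=\beta_j$). $H_k\in\mathbb{R}^{k\times k}$ is the upper Hessenberg matrix with $(H_k)_{i,j}=\theta_{i,j+1}$ for $i\le j$, $(H_k)_{j+1,j}=\beta_{j+1}$, and zeros below the subdiagonal. *)

(* Defs.v *)
From HB Require Import structures.
From mathcomp Require Import all_boot all_order all_algebra.

Set Implicit Arguments.
Unset Strict Implicit.
Unset Printing Implicit Defensive.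

Import Order.TTheory GRing.Theory Num.Theory.
Local Open Scope ring_scope.

(* M is not assumed symmetric, here or in the theorem. *)
Definition posdef (R : rcfType) (m : nat) (M : 'M[R]_m) : Prop :=
  forall x : 'cV[R]_m, x != 0 -> 0 < (x^T *m M *m x) 0 0.

Definition norm2 (R : rcfType) (d : nat) (x : 'cV[R]_d) : R :=
  Num.sqrt ((x^T *m x) 0 0).

Definition normM (R : rcfType) (m : nat) (M : 'M[R]_m) (x : 'cV[R]_m) : R :=
  Num.sqrt ((x^T *m M *m x) 0 0).

Definition upper_hessenberg (R : rcfType) (k : nat) (H : 'M[R]_k) : Prop :=
  forall i j : 'I_k, (j.+1 < i)%N -> H i j = 0.

(* Vectors and scalars of the process carry the usual indices 1, 2, ...,
   whereas rows and columns of matrices are indexed from 0: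
   [cols x k] is the matrix with the k columns x 1, ..., x k. *)
Definition cols (R : rcfType) (d : nat) (x : nat -> 'cV[R]_d) (k : nat) :
  'M[R]_(d, k) := \matrix_(i, j) x j.+1 i 0.

Definition upd (T : Type) (x : nat -> T) (j : nat) (y : T) : nat -> T :=
  fun i => if i == j then y else x i.

Section GolubKahan.

Variables (R : rcfType) (m n : nat).
Variables (M : 'M[R]_m) (A : 'M[R]_(m, n)) (b : 'cV[R]_n).

Section Step.

(* The quantities of step j in terms of the vectors q 1, ..., q j.-1 and
   v 1, ..., v j.-1 of the previous steps. *)
Variables (q : nat -> 'cV[R]_n) (v : nat -> 'cV[R]_m) (j : nat).

Definition step_h : 'cV[R]_j.-1 := (cols q j.-1)^T *m A^T *m v j.-1.

Definition step_g : 'cV[R]_n :=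
  if j == 1%N then b else A^T *m v j.-1 - cols q j.-1 *m step_h.

Definition step_beta : R := norm2 step_g.

Definition step_q : 'cV[R]_n := step_beta^-1 *: step_g.

Definition step_w : 'cV[R]_m :=
  if j == 1%N then invmx M *m A *m step_q
  else invmx M *m (A *m step_q - step_beta *: (M *m v j.-1)).

Definition step_alpha : R := normM M step_w.

Definition step_v : 'cV[R]_m := step_alpha^-1 *: step_w.

End Step.

(* Sequences q and v after k steps; the entries that have not been computed
   are 0.  The recursion does not test for termination: once some beta is 0,
   the later entries are meaningless (the inverse of 0 is 0), and [gk_runs]
   below expresses that this has not happened. *)
Fixpoint gk_iter (k : nat) : (nat -> 'cV[R]_n) * (nat -> 'cV[R]_m) :=
  if k is k'.+1 then
    let: (q, v) := gk_iter k' in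
    (upd q k (step_q q v k), upd v k (step_v q v k))
  else (fun=> 0, fun=> 0).

Definition gk_q (j : nat) : 'cV[R]_n := (gk_iter j).1 j.
Definition gk_v (j : nat) : 'cV[R]_m := (gk_iter j).2 j.

Definition gk_h (j : nat) : 'cV[R]_j.-1 := step_h gk_q gk_v j.
Definition gk_beta (j : nat) : R := step_beta gk_q gk_v j.
Definition gk_alpha (j : nat) : R := step_alpha gk_q gk_v j.

Definition gk_runs (k : nat) : Prop :=
  forall j : nat, (0 < j <= k)%N -> gk_beta j != 0.

Definition gk_Q (k : nat) : 'M[R]_(n, k) := cols gk_q k.
Definition gk_V (k : nat) : 'M[R]_(m, k) := cols gk_v k.

(* With rows and columns indexed from 0, the superdiagonal entry in column j
   is beta_(j+1). *)
Definition gk_B (k : nat) : 'M[R]_k :=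
  \matrix_(i, j) if i == j then gk_alpha j.+1
                 else if j == i.+1 :> nat then gk_beta j.+1
                 else 0.

(* Column j holds the coefficients theta_(1,j+2), ..., theta_(j+1,j+2) of
   h_(j+2), followed by beta_(j+2).  The last column of H_k thus uses
   h_(k+1) = Q_k^T A^T v_k, which is defined even if beta_(k+1) = 0. *)
Definition gk_H (k : nat) : 'M[R]_k :=
  \matrix_(i, j) if (i <= j)%N then gk_h j.+2 (inord i) 0
                 else if i == j.+1 :> nat then gk_beta j.+2
                 else 0.

Lemma gk_iterE k j : (0 < j <= k)%N ->
  (gk_iter k).1 j = gk_q j /\ (gk_iter k).2 j = gk_v j.
Proof.
elim: k => [|k IHk] /andP[j0 jk]; first by case: j j0 jk.
have [->//|jNk] := eqVneq j k.+1.
have {}jk : (j <= k)%N by rewrite -ltnS ltn_neqAle jNk.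
have := IHk; rewrite j0 jk => /(_ isT) /=.
by case: (gk_iter k) => q v /= [<- <-]; rewrite /upd (negPf jNk).
Qed.

Lemma cols_eq (d k : nat) (x y : nat -> 'cV[R]_d) :
  (forall j, (0 < j <= k)%N -> x j = y j) -> cols x k = cols y k.
Proof. by move=> xy; apply/matrixP => i j; rewrite !mxE xy //=. Qed.

Lemma step_eq (q q' : nat -> 'cV[R]_n) (v v' : nat -> 'cV[R]_m) (j : nat) :
    (forall i, (0 < i <= j)%N -> q i = q' i) ->
    (forall i, (0 < i <= j)%N -> v i = v' i) ->
  step_q q v j.+1 = step_q q' v' j.+1 /\ step_v q v j.+1 = step_v q' v' j.+1.
Proof.
move=> qq' vv'; case: j qq' vv' => [|j] qq' vv'; first by [].
by rewrite /step_v /step_alpha /step_w /step_q /step_beta /step_g /step_h /=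
  (cols_eq qq') (vv' j.+1) //=.
Qed.

Lemma gk_stepE j : (0 < j)%N ->
  gk_q j = step_q gk_q gk_v j /\ gk_v j = step_v gk_q gk_v j.
Proof.
case: j => // j _; have Hj i : (0 < i <= j)%N -> _ := @gk_iterE j i.
have /= [<- <-] := step_eq (fun i hi => (Hj i hi).1) (fun i hi => (Hj i hi).2).
rewrite [gk_q j.+1]/gk_q [gk_v j.+1]/gk_v /=.
by case: (gk_iter j) => q v /=; rewrite /upd eqxx.
Qed.

Lemma gk_q1 : gk_q 1 = (norm2 b)^-1 *: b.
Proof. by rewrite (gk_stepE _).1. Qed.

Lemma gk_v1 (w := invmx M *m A *m gk_q 1) : gk_v 1 = (normM M w)^-1 *: w.
Proof. by rewrite /w gk_q1 (gk_stepE _).2. Qed.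

Lemma gk_qS j (g := A^T *m gk_v j.+1 - gk_Q j.+1 *m gk_h j.+2) :
  gk_beta j.+2 = norm2 g /\ gk_q j.+2 = (gk_beta j.+2)^-1 *: g.
Proof. by rewrite (gk_stepE _).1. Qed.

Lemma gk_vS j (w := invmx M *m (A *m gk_q j.+2
                                - gk_beta j.+2 *: (M *m gk_v j.+1))) :
  gk_alpha j.+2 = normM M w /\ gk_v j.+2 = (gk_alpha j.+2)^-1 *: w.
Proof. by rewrite (gk_stepE _).2 // /w (gk_stepE _).1. Qed.

End GolubKahan.

(* Main.v *)
Require Import Defs.
From mathcomp Require Import all_boot all_order all_algebra.

Set Implicit Arguments.
Unset Strict Implicit.
Unset Printing Implicit Defensive.

Import Order.TTheory GRing.Theory Num.Theory.
Local Open Scope ring_scope.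

(** The recurrences of the process are the columns of two matrix identities.
    The definition of w_j gives A q_j = M (alpha_j v_j + beta_j v_(j-1)), that
    is, A Q = M V B ([gk_mulAQ]).  The definition of g_(j+1) gives
    A^T v_j = Q_j h_(j+1) + beta_(j+1) q_(j+1), which is column j of
    A^T V = Q H ([gk_mulATV]) for j < n.  The last column has no q_(n+1): there
    the identity reads A^T v_n = Q Q^T (A^T v_n), and it holds because the n
    columns of Q, orthonormal by the Gram-Schmidt step ([gk_Q_gram]), form an
    orthogonal square matrix.  Hence
    S Q = A^T M^-1 (A Q) = (A^T V) B = Q (H B), and Q^T = Q^-1 gives the
    factorization.  The product H B is upper Hessenberg because H is and B is
    upper triangular.

    The relation w_j = alpha_j v_j, on which A Q = M V B rests, covers the case
    alpha_j = 0 as well, where positive definiteness forces w_j = 0. *)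

(** * Norms and positive definite matrices *)

Lemma dot_mx00 (R : rcfType) (d : nat) (x y : 'cV[R]_d) :
  (x^T *m y) 0 0 = \sum_i x i 0 * y i 0.
Proof. by rewrite mxE; apply: eq_bigr => i _; rewrite mxE. Qed.

Lemma norm2_sqr (R : rcfType) (d : nat) (x : 'cV[R]_d) :
  norm2 x ^+ 2 = (x^T *m x) 0 0.
Proof.
by rewrite sqr_sqrtr // dot_mx00 sumr_ge0 // => i _; rewrite -expr2 sqr_ge0.
Qed.

Lemma normM_eq0 (R : rcfType) (m : nat) (M : 'M[R]_m) (x : 'cV[R]_m) :
  posdef M -> normM M x = 0 -> x = 0.
Proof.
move=> Mpos /eqP; rewrite sqrtr_eq0 => xMx.
by apply/eqP; apply: contraLR xMx => /Mpos; rewrite ltNge.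
Qed.

Lemma posdef_unitmx (R : rcfType) (m : nat) (M : 'M[R]_m) :
  posdef M -> M \in unitmx.
Proof.
move=> Mpos; rewrite unitmxE unitfE; apply/det0P => -[v v0 vM].
by have := Mpos v^T; rewrite trmx_eq0 v0 trmxK vM mul0mx mxE ltxx => /(_ isT).
Qed.

(** * Matrices given by their columns *)

Section Columns.

Variables (R : rcfType) (d : nat).
Implicit Types x : nat -> 'cV[R]_d.

Lemma col_cols x k (j : 'I_k) : col j (cols x k) = x j.+1.
Proof. by apply/colP => i; rewrite !mxE. Qed.

Lemma col_mulmx p k l (X : 'M[R]_(p, k)) (Y : 'M[R]_(k, l)) j :
  col j (X *m Y) = X *m col j Y.
Proof. by rewrite !colE mulmxA. Qed.

Lemma mul_cols x k (c : 'cV[R]_k) : cols x k *m c = \sum_i c i 0 *: x i.+1.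
Proof.
apply/colP => i; rewrite mxE summxE.
by apply: eq_bigr => j _; rewrite !mxE mulrC.
Qed.

Lemma tr_cols_mul x k (y : 'cV[R]_d) (i : 'I_k) :
  ((cols x k)^T *m y) i 0 = ((x i.+1)^T *m y) 0 0.
Proof. by rewrite !mxE; apply: eq_bigr => l _; rewrite !mxE. Qed.

Lemma cols_inj k (X Y : 'M[R]_(d, k)) : (forall j, col j X = col j Y) -> X = Y.
Proof.
by move=> XY; apply/matrixP => i j; move/colP/(_ i): (XY j); rewrite !mxE.
Qed.

End Columns.

(** * Hessenberg and bidiagonal factors *)

Lemma hessenberg_mul_triangular (R : rcfType) (k : nat) (H B : 'M[R]_k) :
    upper_hessenberg H -> (forall i j : 'I_k, (j < i)%N -> B i j = 0) ->
  upper_hessenberg (H *m B).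
Proof.
move=> Hhess Btri i j ji; rewrite mxE big1 // => l _.
have [jl|lj] := ltnP j l; first by rewrite Btri ?mulr0.
by rewrite Hhess ?mul0r //; apply: leq_ltn_trans ji.
Qed.

Section Process.

Variables (R : rcfType) (m n : nat).
Variables (M : 'M[R]_m) (A : 'M[R]_(m, n)) (b : 'cV[R]_n).

Local Notation q := (gk_q M A b).
Local Notation v := (gk_v M A b).
Local Notation alpha := (gk_alpha M A b).
Local Notation beta := (gk_beta M A b).
Local Notation h := (gk_h M A b).
Local Notation Q := (gk_Q M A b).
Local Notation V := (gk_V M A b).

Lemma gk_H_hessenberg k : upper_hessenberg (gk_H M A b k).
Proof.
move=> i j ji; rewrite mxE leqNgt (ltnW ji) /=.
by rewrite gtn_eqF.
Qed.

Lemma gk_B_triangular k (i j : 'I_k) : (j < i)%N -> gk_B M A b k i j = 0.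
Proof.
move=> ji; rewrite mxE -val_eqE /= gtn_eqF //.
by rewrite ltn_eqF // ltnS ltnW.
Qed.

(** * The recurrence for v as A Q = M V B *)

(** For j = 1 the term in beta_1 vanishes because v_0 = 0, which puts the first
    step in the form of the later ones. *)
Lemma gk_mulAq j : posdef M -> (0 < j)%N ->
  A *m q j = M *m (alpha j *: v j + beta j *: v j.-1).
Proof.
move=> Mpos j0; have Munit := posdef_unitmx Mpos.
pose w := step_w M A b q v j.
have wE : alpha j *: v j = w.
  rewrite (gk_stepE M A b j0).2 /step_v -/w scalerA /gk_alpha.
  have [a0|a0] := eqVneq (step_alpha M A b q v j) 0.
    by rewrite a0 mul0r scale0r /w (normM_eq0 Mpos a0).
  by rewrite divff ?scale1r.
have qE : step_q A b q v j = q j by rewrite -(gk_stepE M A b j0).1.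
rewrite wE mulmxDr /w /step_w qE; case: (eqVneq j 1%N) => [->|_].
  by rewrite -mulmxA mulKVmx // scaler0 mulmx0 addr0.
by rewrite mulKVmx // -scalemxAr subrK.
Qed.

Lemma col_gk_VB k (j : 'I_k) :
  col j (V k *m gk_B M A b k) = alpha j.+1 *: v j.+1 + beta j.+1 *: v j.
Proof.
rewrite col_mulmx mul_cols (bigD1 j) //= !mxE eqxx; congr (_ + _).
case: j => -[|j] jk /=.
  rewrite scaler0 big1 // => i ij.
  by rewrite !mxE (negPf ij) scale0r.
rewrite (bigD1 (Ordinal (ltnW jk))) /=; last first.
  by rewrite -val_eqE /= ltn_eqF.
rewrite !mxE -val_eqE /= ltn_eqF // eqxx big1 ?addr0 // => i /andP[ij iNj].
by rewrite !mxE (negPf ij) /= eqSS [j == _]eq_sym ifN ?scale0r.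
Qed.

Lemma gk_mulAQ k : posdef M -> A *m Q k = M *m V k *m gk_B M A b k.
Proof.
move=> Mpos; apply: cols_inj => j.
by rewrite -mulmxA !(col_mulmx A, col_mulmx M) col_gk_VB col_cols gk_mulAq.
Qed.

(** * Orthonormality and A^T V = Q H *)

Lemma gk_beta_q j : (0 < j)%N -> beta j != 0 ->
  beta j *: q j = step_g A b q v j.
Proof.
move=> j0 bj; rewrite (gk_stepE M A b j0).1 /step_q scalerA.
by rewrite divff ?scale1r.
Qed.

Lemma gk_q_unit j : (0 < j)%N -> beta j != 0 -> ((q j)^T *m q j) 0 0 = 1.
Proof.
move=> j0 bj; rewrite (gk_stepE M A b j0).1 /step_q [(_ *: _)^T]linearZ /=.
rewrite -scalemxAl -scalemxAr scalerA mxE -norm2_sqr -expr2 -exprMn.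
by rewrite mulVf ?expr1n.
Qed.

(** The vector g is the residual of a vector after projection on the span of
    the earlier q, whose orthonormality (induction hypothesis) makes the
    residual orthogonal to them. *)
Lemma gk_Q_gram k : gk_runs M A b k -> (Q k)^T *m Q k = 1%:M.
Proof.
elim: k => [|k IHk] runs; first by apply/matrixP => -[].
have {}IHk : (Q k)^T *m Q k = 1%:M.
  by apply: IHk => j /andP[j0 jk]; rewrite runs // j0 leqW.
have gramE l (i j : 'I_l) :
    ((Q l)^T *m Q l) i j = ((q i.+1)^T *m q j.+1) 0 0.
  by rewrite -tr_cols_mul -(col_cols q j) -col_mulmx [RHS]mxE.
have Qq : (Q k)^T *m q k.+1 = 0.
  case: k runs IHk => [|k] runs IHk; first by apply/colP => -[].
  rewrite (gk_qS M A b k).2 -scalemxAr mulmxBr /gk_h /step_h /=.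
  by rewrite !mulmxA IHk mul1mx subrr scaler0.
have orth (i : 'I_k) : ((q i.+1)^T *m q k.+1) 0 0 = 0.
  by rewrite -tr_cols_mul Qq mxE.
apply/matrixP => i j; rewrite gramE [RHS]mxE.
have [i' ->|->] := unliftP ord_max i; have [j' ->|->] := unliftP ord_max j.
- by rewrite !lift_max -gramE IHk mxE (inj_eq lift_inj).
- by rewrite lift_max orth eq_sym (negPf (neq_lift _ _)).
- rewrite lift_max dot_mx00 (negPf (neq_lift _ _)) -[RHS](orth j') dot_mx00.
  by apply: eq_bigr => l _; rewrite mulrC.
- by rewrite eqxx gk_q_unit ?runs ?ltnSn.
Qed.

(** The term in beta_(j+2) is present exactly when row j+1 lies in the
    matrix. *)
Lemma col_gk_QH k (j : 'I_k) :
  col j (Q k *m gk_H M A b k) =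
    Q j.+1 *m h j.+2 + (if (j.+1 < k)%N then beta j.+2 *: q j.+2 else 0).
Proof.
rewrite col_mulmx !mul_cols (bigID (fun i : 'I_k => i <= j)%N) /=.
congr (_ + _).
  pose F i := h j.+2 (inord i) 0 *: q i.+1.
  rewrite (eq_bigr (fun i : 'I_j.+1 => F i)); last first.
    by move=> i _; rewrite /F inord_val.
  rewrite (big_ord_widen k F (ltn_ord j)).
  apply: eq_big => // i ij.
  by rewrite [col _ _ _ _]mxE [gk_H _ _ _ _ _ _]mxE ij.
case: ifPn => [jk|kj].
  rewrite (bigD1 (Ordinal jk)) /=; last by rewrite -ltnNge.
  rewrite !mxE /= ltnn eqxx big1 ?addr0 // => i /andP[ij iNj].
  by rewrite !mxE (negPf ij) /= ifN ?scale0r.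
rewrite big1 // => i ij.
by case/negP: kj; apply: leq_ltn_trans (ltn_ord i); rewrite ltnNge.
Qed.

Lemma gk_mulATV : gk_runs M A b n -> A^T *m V n = Q n *m gk_H M A b n.
Proof.
move=> runs; apply: cols_inj => j.
rewrite col_gk_QH col_mulmx col_cols.
case: ifPn => [jn|nj]; first by rewrite gk_beta_q ?runs //= addrC subrK.
(* Last column: Q is square, so Q^T Q = 1 gives Q Q^T = 1. *)
have jn : j.+1 = n by apply/eqP; rewrite eqn_leq ltn_ord leqNgt nj.
rewrite addr0 /gk_h /step_h /= -/(Q j.+1) jn.
by rewrite !mulmxA (mulmx1C (gk_Q_gram runs)) mul1mx.
Qed.

End Process.

(** * The factorization of the Schur complement *)

Theorem mainTheorem1 (R : rcfType) (m n : nat)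
    (M : 'M[R]_m) (A : 'M[R]_(m, n)) (b : 'cV[R]_n)
    (M_posdef : posdef M)
    (A_full_column_rank : \rank A = n)
    (b_neq0 : b != 0)
    (runs : gk_runs M A b n) :
  let Q := gk_Q M A b n in
  let B := gk_B M A b n in
  let H := gk_H M A b n in
  let S := A^T *m invmx M *m A in
  let HS := H *m B in
  S = Q *m HS *m Q^T /\ upper_hessenberg HS.
Proof.
move=> Q B H S HS; split; last first.
  exact: hessenberg_mul_triangular (@gk_H_hessenberg _ _ _ M A b n)
                                   (@gk_B_triangular _ _ _ M A b n).
have SQ : S *m Q = Q *m HS.
  rewrite /S -!mulmxA gk_mulAQ // -mulmxA mulKmx ?posdef_unitmx //.
  by rewrite mulmxA gk_mulATV // mulmxA.
by rewrite -SQ -mulmxA (mulmx1C (gk_Q_gram runs)) mulmx1.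
Qed.
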